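(* Let $N\ge2$ be an integer, let $f_{\mathrm{sig}}>0$, and let the timing skews $s_0,\dots,s_{N-1}$ be i.i.d. real $\mathcal{N}(0,\sigma_{\mathbf{s}}^2)$ random variables with $\sigma_{\mathbf{s}}>0$. For a single-tone input at frequency $f_{\mathrm{sig}}$, let $P^{\mathrm{s}}_k=(2\pi f_{\mathrm{sig}})^2|\tilde s_k|^2$ be the (first-order) power, relative to the input signal power, of the skew replica associated with DFT bin $k$. Then, for all $p\ge0$: (i) if $N$ is even, $$\Pr\left(P^{\mathrm{s}}_{N/2}\le p\right)=\operatorname{erf}\left(\sqrt{\frac{Np}{8\pi^2f_{\mathrm{sig}}^2\sigma_{\mathbf{s}}^2}}\right);$$ (ii) for every integer $k$ with $0<k<N/2$, $$\Pr\left(P^{\mathrm{s}}_k\le p\right)=1-e^{-\frac{Np}{4\pi^2f_{\mathrm{sig}}^2\sigma_{\mathbf{s}}^2}}.$$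
   Context: The normalized DFT of $\mathbf{s}$ is $\tilde s_k=\frac1N\sum_{n=0}^{N-1}e^{-2\pi j kn/N}s_n$, $k=0,\dots,N-1$, with $j$ the imaginary unit. In an $N$-fold interleaved ADC with timing skews $s_n$, to first order in the skews the output spectrum contains replicas of the differentiated input spectrum $2\pi j f X(f)$, shifted by $kf_s/N$ and scaled by $-\tilde s_k$; for a single tone at $f_{\mathrm{sig}}$ the replica-to-input power ratio is therefore $(2\pi f_{\mathrm{sig}})^2|\tilde s_k|^2$. The bin $k=0$ is disregarded. $\mathcal{N}(0,\sigma^2)$ is the zero-mean real Gaussian distribution of variance $\sigma^2$, and $\operatorname{erf}(x)=\frac{2}{\sqrt\pi}\int_0^x e^{-u^2}du$. *)

(* Defs.v *)
From mathcomp Require Export all_boot all_order all_algebra.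
From mathcomp Require Export complex.
From mathcomp Require Export all_classical all_reals all_analysis.

Set Implicit Arguments.
Unset Strict Implicit.
Unset Printing Implicit Defensive.

Import Order.TTheory GRing.Theory Num.Theory.
Import numFieldNormedType.Exports.

Local Open Scope classical_set_scope.
Local Open Scope ring_scope.
Local Open Scope complex_scope.

Definition cexp (R : realType) (z : R[i]) : R[i] :=
  (expR (complex.Re z) * cos (complex.Im z)) +i*
  (expR (complex.Re z) * sin (complex.Im z)).

(* The bins are k = 0, ..., N-1; for other k this is the N-periodic extension. *)
Definition dft (R : realType) (N : nat) (s : 'I_N -> R) (k : nat) : R[i] :=
  (N%:R)^-1 *
  \sum_(n < N) cexp ((- (2 * pi * k%:R * n%:R / N%:R)) *i) * (s n)%:C.

(* The norm of the numeric field R[i] is R[i]-valued; normc is the modulus as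
   an element of R. *)
Definition skew_power (R : realType) (N : nat) (fsig : R) (s : 'I_N -> R)
    (k : nat) : R :=
  (2 * pi * fsig) ^+ 2 * (ComplexField.Normc.normc (dft s k)) ^+ 2.

(* The case split gives the oriented integral from 0 to x for negative x. *)
Definition erf (R : realType) (x : R) : R :=
  2 / Num.sqrt pi *
  (if 0 <= x then \int[lebesgue_measure]_(u in `[0, x]) expR (- u ^+ 2)
   else - \int[lebesgue_measure]_(u in `[x, 0]) expR (- u ^+ 2)).

Definition mutually_independent (d : measure_display) (T : measurableType d)
    (R : realType) (P : probability T R) (I : finType)
    (X : I -> {RV P >-> R}) : Prop :=
  forall (J : {set I}) (B : I -> set R),
    (forall i, measurable (B i)) ->
    P (\bigcap_(i in [set` J]) (X i @^-1` B i)) =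
    (\prod_(i in J) P (X i @^-1` B i))%E.

(* The second parameter of normal_prob is the standard deviation.  The laws are
   compared on measurable sets because a measure in the library is a function
   defined on all sets. *)
Definition has_normal_law (d : measure_display) (T : measurableType d)
    (R : realType) (P : probability T R) (X : {RV P >-> R}) (m sigma : R) : Prop :=
  forall B : set R, measurable B -> distribution P X B = normal_prob m sigma B.

(* Main.v *)
From HB Require Import structures.
Require Import Defs.
From mathcomp Require Import unstable all_classical all_reals all_analysis.
From mathcomp Require Import measurable_realfun ring lra.

(** Givens rotations preserve the joint law of an i.i.d. centered Gaussian
family, because planar Lebesgue measure is invariant under shears, hence under
rotations, and the density of a pair depends only on its squared norm.
Finitely many of them carry two orthogonal coefficient vectors to multiples of
two basis vectors, so the real and imaginary parts of a DFT bin become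
independent centered Gaussians of equal variance for [0 < k < N/2], while for
[k = N/2] only the real part survives.  One Gaussian gives erf; for two, the
area of a disk is linear in its squared radius, so the law of the squared norm
has an exponential density, normalized by its total mass. *)

Import Order.TTheory GRing.Theory Num.Theory.
Import numFieldNormedType.Exports.

Local Open Scope classical_set_scope.
Local Open Scope ring_scope.

Set Implicit Arguments.
Unset Strict Implicit.
Unset Printing Implicit Defensive.

(* The pushforward with its measure structure, as a function of the proof of
   measurability, which unification cannot find by itself. *)
Local Notation pushforward_measure :=
  measure_function_pushforward__canonical__measure_function_Measure.

(** * Shears and rotations of the plane *)

Section planar_lebesgue.
Context {R : realType}.
Local Notation lam := (@lebesgue_measure R).
Local Notation lam2 := (lam \x lam)%E.

Lemma measurable_preimage d1 d2 (T1 : measurableType d1) (T2 : measurableType d2)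
    (f : T1 -> T2) (A : set T2) :
  measurable_fun setT f -> measurable A -> measurable (f @^-1` A).
Proof. by move=> mf mA; rewrite -[X in measurable X]setTI; exact: mf. Qed.

(** Lebesgue measure is characterized by its values on the intervals []u, v]]. The preimage of such
    an interval has length [(v - u) / c], so the pushforward scaled by [c] has the right values. *)
Lemma lebesgue_measure_affine (c a : R) (A : set R) : 0 < c -> measurable A ->
  (c%:E * lam ((fun x => c * x + a)%R @^-1` A))%E = lam A.
Proof.
move=> c0 mA.
have mf : measurable_fun [set: measurableTypeR R]
    (fun x : measurableTypeR R => (c * x + a : measurableTypeR R)).
  by apply: measurable_funD => //; apply: measurable_funM.
set F := (fun x => _) in mf *.
have c0' : 0 <= c by exact: ltW.
pose m' := mscale (NngNum c0')
    (pushforward_measure lam mf).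
rewrite [RHS](@lebesgue_measure_unique R m')//= => _ [[u v]] _ <-.
rewrite /m' /mscale/= /pushforward/=.
have -> : F @^-1` `]u, v]%classic = `](u - a) / c, (v - a) / c]%classic.
  apply/seteqP; split=> x /=; rewrite !in_itv/= /F => /andP[].
    move=> h1 h2; rewrite ltr_pdivrMr// ler_pdivlMr//; apply/andP; split; lra.
  by rewrite ltr_pdivrMr// ler_pdivlMr// => h1 h2; apply/andP; split; lra.
rewrite !lebesgue_measure_itv/= !lte_fin ltr_pM2r ?invr_gt0// ltrD2r.
case: ifPn => uv; last by rewrite mule0.
by rewrite -EFinB -EFinM; congr EFin; field; rewrite gt_eqF.
Qed.

Lemma lebesgue_measure_shift (a : R) (A : set R) : measurable A ->
  lam ((fun x => x + a) @^-1` A) = lam A.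
Proof.
move=> mA; rewrite -[RHS](@lebesgue_measure_affine 1 a)// mul1e.
by congr (lam (_ @^-1` A)); apply/funext => x; rewrite mul1r.
Qed.

Definition vshear (a : R) (z : R * R) : R * R := (z.1, z.2 + a * z.1).
Definition hshear (a : R) (z : R * R) : R * R := (z.1 + a * z.2, z.2).

Lemma measurable_vshear a : measurable_fun setT (vshear a).
Proof.
apply: measurable_fun_pair => //.
by apply: measurable_funD => //; apply: measurable_funM.
Qed.

Lemma measurable_hshear a : measurable_fun setT (hshear a).
Proof.
apply: measurable_fun_pair => //.
by apply: measurable_funD => //; apply: measurable_funM.
Qed.

(** The product measure integrates the measures of the vertical sections, and the shear translates
    each of them by an amount depending only on the abscissa. *)
Lemma lebesgue2_vshear (a : R) (A : set (R * R)) : measurable A ->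
  lam2 (vshear a @^-1` A) = lam2 A.
Proof.
move=> mA; apply: eq_integral => x _ /=.
rewrite -[RHS](@lebesgue_measure_shift (a * x)); last exact: measurable_xsection.
by congr (lam _); apply/seteqP; split => y; rewrite /= /xsection/= !inE.
Qed.

(** Gives access to horizontal sections, which a horizontal shear translates. Both iterated measures
    agree on rectangles, hence everywhere. *)
Lemma lebesgue2_ysection (A : set (R * R)) : measurable A ->
  lam2 A = (lam \x^ lam)%E A.
Proof.
by move=> mA; apply: product_measure_unique => //= ? ? ? ?; rewrite product_measure2E.
Qed.

Lemma lebesgue2_hshear (a : R) (A : set (R * R)) : measurable A ->
  lam2 (hshear a @^-1` A) = lam2 A.
Proof.
move=> mA; rewrite !lebesgue2_ysection//; last first.
  by apply: measurable_preimage => //; exact: measurable_hshear.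
apply: eq_integral => y _ /=.
rewrite -[RHS](@lebesgue_measure_shift (a * y)); last exact: measurable_ysection.
by congr (lam _); apply/seteqP; split => x; rewrite /= /ysection/= !inE.
Qed.

Definition rotate2 (c s : R) (z : R * R) : R * R :=
  (c * z.1 + s * z.2, c * z.2 - s * z.1).

Lemma measurable_rotate2 (c s : R) : measurable_fun setT (rotate2 c s).
Proof.
by apply: measurable_fun_pair; [apply: measurable_funD|apply: measurable_funB];
  apply: measurable_funM.
Qed.

(** The three-shear factorization of a rotation; [(1 - c) / s] is the tangent of the half angle,
    finite because [s != 0]. *)
Lemma rotate2_shear (c s : R) : c ^+ 2 + s ^+ 2 = 1 -> s != 0 ->
  rotate2 c s = hshear ((1 - c) / s) \o (vshear (- s) \o hshear ((1 - c) / s)).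
Proof.
move=> cs s0; apply/funext => -[x y]; rewrite /rotate2 /hshear /vshear/=.
have s2 : s ^+ 2 = 1 - c ^+ 2 by rewrite -cs addrC addKr.
by congr (_, _); [apply: (mulfI s0); field: s2|field].
Qed.

Lemma lebesgue2_rotate2 (c s : R) (A : set (R * R)) : c ^+ 2 + s ^+ 2 = 1 -> s != 0 ->
  measurable A -> lam2 (rotate2 c s @^-1` A) = lam2 A.
Proof.
move=> cs s0 mA; 
pose B := hshear ((1 - c) / s) @^-1` A; pose C := vshear (- s) @^-1` B.
have mB : measurable B.
  by apply: measurable_preimage => //; exact: measurable_hshear.
have mC : measurable C.
  by apply: measurable_preimage => //; exact: measurable_vshear.
have -> : rotate2 c s @^-1` A = hshear ((1 - c) / s) @^-1` C by rewrite rotate2_shear.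
by rewrite lebesgue2_hshear// lebesgue2_vshear// lebesgue2_hshear.
Qed.

End planar_lebesgue.

(** * The planar Gaussian measure *)

(** Change of variables along [phi]: the pushforward of [mu] is [mu] itself, and composing with
    [phi] leaves the integrand unchanged. *)
Lemma ge0_integral_invariant d (T : measurableType d) (R : realType)
    (mu : {measure set T -> \bar R}) (phi : T -> T) (f : T -> \bar R) (A : set T) :
  measurable_fun setT phi ->
  (forall B, measurable B -> mu (phi @^-1` B) = mu B) ->
  measurable_fun setT f -> (forall z, 0 <= f z)%E ->
  (forall z, f (phi z) = f z) -> measurable A ->
  (\int[mu]_(z in phi @^-1` A) f z = \int[mu]_(z in A) f z)%E.
Proof.
move=> mphi phimu mf f0 fphi mA.
transitivity (\int[pushforward mu phi]_(z in A) f z)%E; last first.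
  by apply: eq_measure_integral => // B mB _; exact: phimu.
rewrite ge0_integral_pushforward//; last exact: measurable_funTS.
by apply: eq_integral => z _ /=.
Qed.

Section planar_gaussian.
Context {R : realType} (sigma : R).
Hypothesis sigma_gt0 : 0 < sigma.
Local Notation lam := (@lebesgue_measure R).
Local Notation lam2 := (lam \x lam)%E.
Local Notation N := (normal_prob 0 sigma).
Local Notation g := (normal_pdf 0 sigma).

Definition gauss2_pdf (z : R * R) : R := g z.1 * g z.2.

Lemma gauss2_pdf_ge0 z : 0 <= gauss2_pdf z.
Proof. by rewrite mulr_ge0// normal_pdf_ge0. Qed.

Lemma measurable_gauss2_pdf : measurable_fun setT gauss2_pdf.
Proof.
by apply: measurable_funM; apply: measurableT_comp => //;
  exact: measurable_normal_pdf.
Qed.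

(** Given by its density rather than as a product measure, so that rotation invariance can be read
    off the integrand; [gauss2X] recovers the product form. *)
Definition gauss2 (A : set (R * R)) : \bar R :=
  (\int[lam2]_(z in A) (gauss2_pdf z)%:E)%E.

Let gauss2_0 : gauss2 set0 = 0%E. Proof. by rewrite /gauss2 integral_set0. Qed.

Let gauss2_ge0 A : (0 <= gauss2 A)%E.
Proof. by apply: integral_ge0 => z _; rewrite lee_fin gauss2_pdf_ge0. Qed.

Let gauss2_sigma_additive : semi_sigma_additive gauss2.
Proof.
move=> /= F mF tF mUF; rewrite /gauss2; apply: cvg_toP.
  apply: ereal_nondecreasing_is_cvgn => m n mn.
  by apply: lee_sum_nneg_natr => // k _ _; exact: gauss2_ge0.
rewrite ge0_integral_bigcup//=.
  apply/measurable_funTS/measurable_EFinP; exact: measurable_gauss2_pdf.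
by move=> x _; rewrite lee_fin gauss2_pdf_ge0.
Qed.

HB.instance Definition _ := isMeasure.Build _ _ _
  gauss2 gauss2_0 gauss2_ge0 gauss2_sigma_additive.

Lemma gauss2X (A B : set R) : measurable A -> measurable B ->
  gauss2 (A `*` B) = (N A * N B)%E.
Proof.
move=> mA mB; rewrite /gauss2 integral_mkcond.
have mAB : measurable (A `*` B) by exact: measurableX.
have mf : measurable_fun setT ((EFin \o gauss2_pdf) \_ (A `*` B)).
  apply: (measurable_restrictT _ mAB).1.
  by apply/measurable_funTS/measurable_EFinP; exact: measurable_gauss2_pdf.
rewrite fubini_tonelli1//=; last first.
  by move=> z; apply: erestrict_ge0 => *; rewrite lee_fin gauss2_pdf_ge0.
have mg (C : set R) : measurable C -> measurable_fun setT (EFin \o (g \_ C)).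
  move=> mC; apply/measurable_EFinP; apply: (measurable_restrictT _ mC).1.
  by apply: measurable_funTS; exact: measurable_normal_pdf.
have g0 (C : set R) x : 0 <= (g \_ C) x.
  by apply: restrict_ge0 => *; exact: normal_pdf_ge0.
have NE (C : set R) : N C = (\int[lam]_x ((g \_ C) x)%:E)%E.
  by rewrite /normal_prob integral_mkcond; apply: eq_integral => x _;
    rewrite /patch; case: ifP.
have N0 (C : set R) : (0 <= N C)%E.
  by rewrite NE; apply: integral_ge0 => x _; rewrite lee_fin.
transitivity (\int[lam]_x (((g \_ A) x)%:E * N B))%E; last first.
  by rewrite ge0_integralZr// ?NE//; [exact: mg|move=> x _; rewrite lee_fin].
apply: eq_integral => x _; rewrite NE -ge0_integralZl//; last 3 first.
- exact: mg.
- by move=> y _; rewrite lee_fin.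
- by rewrite lee_fin.
(* The indicator of a rectangle is the product of the indicators of its sides. *)
apply: eq_integral => y _; rewrite -EFinM /patch.
by rewrite in_setX; case: (x \in A); case: (y \in B); rewrite ?mulr0 ?mul0r.
Qed.

Lemma gauss2_pdfE z : gauss2_pdf z =
  normal_peak sigma ^+ 2 * expR (- (z.1 ^+ 2 + z.2 ^+ 2) / (2 * sigma ^+ 2)).
Proof.
rewrite /gauss2_pdf !normal_pdfE ?gt_eqF// /normal_fun !subr0.
rewrite mulrACA -expr2 -expRD; congr (_ * expR _).
by field; rewrite gt_eqF.
Qed.

Lemma gauss2_pdf_rotate2 (c s : R) z : c ^+ 2 + s ^+ 2 = 1 ->
  gauss2_pdf (rotate2 c s z) = gauss2_pdf z.
Proof.
move=> cs; rewrite [LHS]gauss2_pdfE [RHS]gauss2_pdfE.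
have -> : (rotate2 c s z).1 ^+ 2 + (rotate2 c s z).2 ^+ 2 = z.1 ^+ 2 + z.2 ^+ 2.
  rewrite -[RHS]mul1r -cs /rotate2 /=; ring.
by [].
Qed.

Lemma gauss2_rotate2 (c s : R) (A : set (R * R)) : c ^+ 2 + s ^+ 2 = 1 -> s != 0 ->
  measurable A -> gauss2 (rotate2 c s @^-1` A) = gauss2 A.
Proof.
move=> cs s0 mA; apply: ge0_integral_invariant => //.
- exact: measurable_rotate2.
- by move=> B mB; exact: lebesgue2_rotate2.
- by apply/measurable_EFinP; exact: measurable_gauss2_pdf.
- by move=> z; rewrite lee_fin gauss2_pdf_ge0.
- by move=> z; rewrite gauss2_pdf_rotate2.
Qed.

End planar_gaussian.

(** * Givens rotations of i.i.d. Gaussian families *)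

Section givens.
Context {R : realType} {I : finType}.

Definition givens (i j : I) (c s : R) (f : I -> R) (k : I) : R :=
  if k == i then (rotate2 c s (f i, f j)).1
  else if k == j then (rotate2 c s (f i, f j)).2 else f k.

(** Only the terms [i] and [j] change, and a planar rotation preserves their joint contribution. The
    bilinear form covers both squared norms and inner products. *)
Lemma sum_givens (i j : I) (c s : R) (f g : I -> R) :
  c ^+ 2 + s ^+ 2 = 1 -> i != j ->
  \sum_k givens i j c s f k * givens i j c s g k = \sum_k f k * g k.
Proof.
move=> cs ij; rewrite (bigD1 i)//= (bigD1 j) 1?eq_sym//= addrA.
rewrite [RHS](bigD1 i)//= [in RHS](bigD1 j) 1?eq_sym//= addrA.
congr (_ + _); last first.
  by apply: eq_bigr => k /andP[/negbTE ki /negbTE kj]; rewrite /givens ki kj.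
rewrite /givens eqxx eq_sym (negbTE ij) eqxx /rotate2/=.
transitivity ((c ^+ 2 + s ^+ 2) * (f i * g i + f j * g j)); first ring.
by rewrite cs mul1r.
Qed.

End givens.

(** Rectangles are stable under intersection and generate the product sigma-algebra; by finiteness,
    the constant sequence [setT] serves as the exhausting cover. *)
Lemma finite_measure_unique_rect d1 d2 (T1 : measurableType d1)
    (T2 : measurableType d2) (R : realType)
    (m1 m2 : {measure set (T1 * T2) -> \bar R}) :
  (m1 setT < +oo)%E ->
  (forall A B, measurable A -> measurable B -> m1 (A `*` B) = m2 (A `*` B)) ->
  forall X, measurable X -> m1 X = m2 X.
Proof.
move=> m1T m12 X mX.
apply: (measure_unique [set A `*` B | A in measurable & B in measurable]
  (fun=> setT)) => //.
- by rewrite measurable_prod_measurableType.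
- move=> _ _ [A1 mA1 [B1 mB1 <-]] [A2 mA2 [B2 mB2 <-]].
  rewrite -setXI; exists (A1 `&` A2); first exact: measurableI.
  by exists (B1 `&` B2) => //; exact: measurableI.
- by move=> _; exists setT => //; exists setT => //; rewrite setXTT.
- by rewrite bigcup_const//; exists 0%N.
- by move=> _ [A mA [B mB <-]]; exact: m12.
Qed.

Section iid_normal.
Context {d : measure_display} {T : measurableType d} {R : realType}.
Variables (P : probability T R) (I : finType) (sigma : R).
Hypothesis sigma_gt0 : 0 < sigma.
Local Notation N := (normal_prob 0 sigma).

(* Taking some [B i] to be [setT] gives the product rule for subfamilies. *)
Definition iid_normal (X : I -> T -> R) : Prop :=
  (forall i, measurable_fun setT (X i)) /\
  forall B : I -> set R, (forall i, measurable (B i)) ->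
    P [set w | forall i, B i (X i w)] = (\prod_i N (B i))%E.

(** An arbitrary planar set [C] is allowed because a rotation does not send rectangles to
    rectangles. Both sides are measures in [C], so comparing them on rectangles suffices. *)
Lemma iid_normal_pair (X : I -> T -> R) (i j : I) (B : I -> set R)
    (C : set (R * R)) :
  iid_normal X -> i != j -> (forall k, measurable (B k)) -> measurable C ->
  P [set w | C (X i w, X j w) /\ forall k, k != i -> k != j -> B k (X k w)] =
  (gauss2 sigma C * \prod_(k | (k != i) && (k != j)) N (B k))%E.
Proof.
move=> [mX iidX] ij mB mC.
pose E := [set w | forall k, k != i -> k != j -> B k (X k w)].
have mE : measurable E.
  have -> : E = \bigcap_(k in [set k | (k != i) && (k != j)]) X k @^-1` B k.
    apply/seteqP; split=> w /= h k; first by move=> /= /andP[? ?]; exact: h.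
    by move=> ki kj; apply: h; rewrite /= ki kj.
  apply: fin_bigcap_measurable => [|k _]; first exact: finite_finset.
  exact: measurable_preimage.
have mXX : measurable_fun setT (fun w => (X i w, X j w)).
  exact: measurable_fun_pair.
(* [mscale] takes a nonnegative real, hence the passage to finite parts. *)
pose p := (\prod_(k | (k != i) && (k != j)) fine (N (B k)))%R.
have p0 : 0 <= p by apply: prodr_ge0 => k _; rewrite fine_ge0// measure_ge0.
have pE : (\prod_(k | (k != i) && (k != j)) N (B k) = p%:E)%E.
  rewrite /p -prodEFin; apply: eq_bigr => k _; rewrite fineK//.
  by apply: fin_num_measure; exact: mB.
pose m1 := pushforward_measure
  (mrestr P mE) mXX.
pose m2 := mscale (NngNum p0) (gauss2 sigma).
rewrite pE muleC.
apply: (@finite_measure_unique_rect _ _ _ _ _ m1 m2) => //.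
  rewrite /m1/= /pushforward /mrestr/= preimage_setT setTI.
  by rewrite (le_lt_trans (probability_le1 P mE)) ?ltry.
move=> A1 A2 mA1 mA2; transitivity (p%:E * (N A1 * N A2))%E; last by rewrite -gauss2X.
rewrite /m1/= /pushforward /mrestr.
(* A rectangle condition on the pair is absorbed into the product rule by inserting its sides at [i]
   and [j]. *)
pose B' k := if k == i then A1 else if k == j then A2 else B k.
have mB' k : measurable (B' k).
  by rewrite /B'; case: ifP => // _; case: ifP.
transitivity (\prod_k N (B' k))%E.
  rewrite -iidX//; congr (P _); apply/seteqP; split => w /=.
    move=> [[h1 h2] h] k; rewrite /B'.
    by case: eqVneq => [->//|ki]; case: eqVneq => [->//|kj]; exact: h.
  move=> h; split; last first.
    by move=> k ki kj; have := h k; rewrite /B' (negbTE ki) (negbTE kj).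
  split=> /=; first by have := h i; rewrite /B' eqxx.
  by have := h j; rewrite /B' eq_sym (negbTE ij) eqxx.
rewrite (bigD1 i)//= (bigD1 j) 1?eq_sym//= {1 2}/B' eqxx eq_sym (negbTE ij) eqxx.
rewrite muleA muleC; congr (_ * _)%E; rewrite -pE; apply: eq_bigr => k.
by move=> /andP[/negbTE ki /negbTE kj]; rewrite /B' ki kj.
Qed.

Lemma iid_normal_pairT (X : I -> T -> R) (i j : I) (C : set (R * R)) :
  iid_normal X -> i != j -> measurable C ->
  P [set w | C (X i w, X j w)] = gauss2 sigma C.
Proof.
move=> iidX ij mC; have := @iid_normal_pair X i j (fun=> setT) C iidX ij.
rewrite big1 ?mule1 => [<-//|k _]; last exact: probability_setT.
by congr (P _); apply/seteqP; split => w //= [].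
Qed.

Lemma iid_normal1 (X : I -> T -> R) (i : I) (A : set R) :
  iid_normal X -> measurable A -> P [set w | A (X i w)] = N A.
Proof.
move=> [mX iidX] mA; pose B k := if k == i then A else setT.
transitivity (\prod_k N (B k))%E.
  rewrite -iidX; last by move=> k; rewrite /B; case: ifP.
  congr (P _); apply/seteqP; split => w /= h => [k|].
    by rewrite /B; case: eqVneq => [->|].
  by have := h i; rewrite /B eqxx.
rewrite (bigD1 i)//= big1 ?mule1 /B ?eqxx// => k /negbTE ->.
exact: probability_setT.
Qed.

(** The conditions at [i] and [j] pull back to a rotated rectangle for the original pair; [gauss2]
    does not see the rotation and factors again. *)
Lemma iid_normal_givens (X : I -> T -> R) (i j : I) (c s : R) :
  c ^+ 2 + s ^+ 2 = 1 -> s != 0 -> i != j ->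
  iid_normal X -> iid_normal (fun k w => givens i j c s (X ^~ w) k).
Proof.
move=> cs s0 ij iidX; have [mX _] := iidX; split=> [k|B mB].
  rewrite /givens /rotate2/=; case: (k == i) => //=.
    by apply: measurable_funD; apply: measurable_funM.
  case: (k == j) => //=.
  by apply: measurable_funB; apply: measurable_funM.
have mBB : measurable (B i `*` B j) by exact: measurableX.
transitivity (P [set w | (rotate2 c s @^-1` (B i `*` B j)) (X i w, X j w) /\
    forall k, k != i -> k != j -> B k (X k w)]).
  congr (P _); apply/seteqP; split => w /=.
    move=> h; split.
      have := h i; have := h j; rewrite /givens !eqxx eq_sym (negbTE ij).
      by split.
    by move=> k ki kj; have := h k; rewrite /givens (negbTE ki) (negbTE kj).
  move=> [[h1 h2] h] k; rewrite /givens.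
  by case: eqVneq => [->//|ki]; case: eqVneq => [->//|kj]; exact: h.
rewrite iid_normal_pair//; last first.
  by apply: measurable_preimage => //; exact: measurable_rotate2.
rewrite gauss2_rotate2// gauss2X// [RHS](bigD1 i)//= [in RHS](bigD1 j) 1?eq_sym//=.
by rewrite muleA.
Qed.

(* [Y] is the image of [X] under an orthogonal map sending the coefficient
   vector [u] to [r] times the basis vector [i0]. *)
Lemma iid_normal_reduce (A : {set I}) (i0 : I) (u : I -> R) (X : I -> T -> R) :
  i0 \in A -> (forall i, i \notin A -> u i = 0) -> iid_normal X ->
  exists Y r, [/\ iid_normal Y, forall i, i \notin A -> Y i = X i,
    r ^+ 2 = \sum_i u i ^+ 2,
    forall w, \sum_i u i * X i w = r * Y i0 w &
    forall v, exists v', [/\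
      forall w, \sum_i v i * X i w = \sum_i v' i * Y i w,
      \sum_i v i ^+ 2 = \sum_i v' i ^+ 2 &
      \sum_i u i * v i = r * v' i0]].
Proof.
(* Induction on the number of nonzero coordinates of [u] other than [i0]; each rotation removes
   one. *)
move=> i0A; have [n] := ubnP #|[pred i | (i != i0) && (u i != 0)]|.
elim: n u X => // n IH u X /[!ltnS] cn uA iidX.
have [/existsP[j /andP[ji uj]]|] := boolP [exists j, (j != i0) && (u j != 0)];
  last first.
  rewrite negb_exists => /forallP u0.
  have {}u0 i : i != i0 -> u i = 0.
    by move=> ii0; have := u0 i; rewrite ii0/= negbK => /eqP.
  exists X, (u i0); split => //.
  - by rewrite (bigD1 i0)//= big1 ?addr0// => i /u0 ->; rewrite expr0n.
  - by move=> w; rewrite (bigD1 i0)//= big1 ?addr0// => i /u0 ->; rewrite mul0r.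
  - move=> v; exists v; split => //.
    by rewrite (bigD1 i0)//= big1 ?addr0// => i /u0 ->; rewrite mul0r.
(* The rotation with cosine [u i0 / q] and sine [u j / q] sends [(u i0, u j)] to [(q, 0)]. *)
pose q := Num.sqrt (u i0 ^+ 2 + u j ^+ 2).
have q2 : q ^+ 2 = u i0 ^+ 2 + u j ^+ 2 by rewrite sqr_sqrtr// addr_ge0 ?sqr_ge0.
have q0 : q != 0.
  rewrite -sqrf_eq0 q2 gt_eqF// ltr_wpDl ?sqr_ge0//.
  by rewrite lt_def sqrf_eq0 uj sqr_ge0.
pose c := u i0 / q; pose s := u j / q.
have cs : c ^+ 2 + s ^+ 2 = 1.
  by rewrite !expr_div_n -mulrDl -q2 divff// sqrf_eq0.
have s0 : s != 0 by rewrite mulf_neq0 ?invr_eq0.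
have ij : i0 != j by rewrite eq_sym.
have jA : j \in A by apply: contraNT uj => /uA ->.
pose G := givens i0 j c s.
have Gout f i : i \notin A -> G f i = f i.
  move=> iA; rewrite /G /givens.
  case: eqVneq => [ii|_]; first by rewrite ii i0A in iA.
  by case: eqVneq => [ii|//]; rewrite ii jA in iA.
have Gu2 : \sum_i u i ^+ 2 = \sum_i G u i ^+ 2.
  by under eq_bigr do rewrite expr2;
    under [RHS]eq_bigr do rewrite expr2; rewrite sum_givens.
have GX v w : \sum_i v i * X i w = \sum_i G v i * G (X ^~ w) i.
  by rewrite sum_givens.
have := IH (G u) (fun k w => G (X ^~ w) k).
case.
(* Coordinate [j] leaves the support; among the coordinates other than [i0], none enters it. *)
- apply: leq_trans cn; apply: proper_card; apply/fintype.properP; split.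
    apply/fintype.subsetP => i; rewrite !inE => /andP[ii0]; rewrite ii0/=.
    rewrite /G /givens (negbTE ii0); case: (eqVneq i j) => [->//|//].
  exists j; rewrite !inE ji// /G /givens (negbTE ji) eqxx /rotate2/= negbK.
  by rewrite /c /s -mulrAC [_ / q * u i0]mulrAC [u i0 * _]mulrC subrr.
- by move=> i iA; rewrite Gout// uA.
- exact: iid_normal_givens.
move=> Y [r [iidY YX r2 uY vY]]; exists Y, r; split => //.
- by move=> i iA; rewrite YX//; apply/funext => w; rewrite Gout.
- by rewrite r2.
- by move=> w; rewrite GX.
- move=> v; have [v' [vX v2 uv]] := vY (G v); exists v'; split.
  + by move=> w; rewrite GX.
  + rewrite -v2; under eq_bigr do rewrite expr2.
    by under [RHS]eq_bigr do rewrite expr2; rewrite sum_givens.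
  + by rewrite -uv sum_givens.
Qed.

End iid_normal.

(** * Gaussian measure of a disk *)

Section disk_area.
Context {R : realType}.
Local Notation lam := (@lebesgue_measure R).
Local Notation lam2 := (lam \x lam)%E.

Definition sqnorm (z : R * R) : R := z.1 ^+ 2 + z.2 ^+ 2.

Lemma measurable_sqnorm : measurable_fun setT sqnorm.
Proof. by apply: measurable_funD; apply: measurable_funX. Qed.

Lemma sqnorm_ge0 z : 0 <= sqnorm z.
Proof. by rewrite addr_ge0 ?sqr_ge0. Qed.

(** Indexed by the squared radius, in which area is linear; empty for negative [t]. *)
Definition disk (t : R) : set (R * R) := [set z | sqnorm z <= t].

Lemma measurable_disk t : measurable (disk t).
Proof.
have -> : disk t = sqnorm @^-1` `]-oo, t] by apply/seteqP; split => z /=; rewrite in_itv.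
by apply: measurable_preimage => //; exact: measurable_sqnorm.
Qed.

(** By uniqueness of the product measure it is enough to treat rectangles, where each side
    contributes one factor [r]. *)
Lemma lebesgue2_scale (r : R) (A : set (R * R)) : 0 < r -> measurable A ->
  ((r ^+ 2)%:E * lam2 ((fun z => (r * z.1, r * z.2)%R) @^-1` A))%E = lam2 A.
Proof.
move=> r0 mA.
have mf : measurable_fun [set: measurableTypeR R * measurableTypeR R]
    (fun z : measurableTypeR R * measurableTypeR R =>
      ((r * z.1, r * z.2) : measurableTypeR R * measurableTypeR R)).
  by apply: measurable_fun_pair; apply: measurable_funM.
set F := (fun z => _) in mf *.
pose m' := mscale (NngNum (sqr_ge0 r))
  (pushforward_measure lam2 mf).
symmetry; apply: (@product_measure_unique _ _ _ _ _ _ _ m') => // B C mB mC.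
have mscl (D : set R) : measurable D ->
    measurable ((fun x => r * x + 0) @^-1` D).
  by move=> mD; apply: measurable_preimage => //; apply: measurable_funD => //;
    apply: measurable_funM.
transitivity (lam B * lam C)%E; last by [].
have -> : lam B = (r%:E * lam ((fun x => r * x + 0)%R @^-1` B))%E.
  by rewrite lebesgue_measure_affine.
have -> : lam C = (r%:E * lam ((fun x => r * x + 0)%R @^-1` C))%E.
  by rewrite lebesgue_measure_affine.
rewrite muleACA -EFinM -expr2 -product_measure1E//; [|exact: mscl..].
congr (_ * lam2 _)%E; apply/seteqP; split => z /=; rewrite /F/= !addr0//.
Qed.

(** The disk lies in the square of side 2. Finiteness lets its area act as a real scaling factor,
    whose value is later absorbed by the total mass of the Gaussian. *)
Lemma lebesgue2_disk1_lty : (lam2 (disk 1) < +oo)%E.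
Proof.
pose I1 : set R := `[-1, 1]%classic.
have mI : measurable I1 by exact: measurable_itv.
apply: (@le_lt_trans _ _ (lam2 (I1 `*` I1))).
  apply: le_measure; rewrite ?inE//; [exact: measurable_disk|exact: measurableX|].
  move=> [x y]; rewrite /disk/= /sqnorm/= => xy.
  have := sqr_ge0 x; have := sqr_ge0 y => y0 x0.
  by split; rewrite /I1/= in_itv/=; apply/andP; split; nra.
have -> : lam2 (I1 `*` I1) = (lam I1 * lam I1)%E by exact: product_measure1E.
rewrite /I1 lebesgue_measure_itv/= lte_fin.
by case: ifP => _; rewrite -?EFinB -?EFinM ?mule0 ltry.
Qed.

Lemma lebesgue2_disk (t : R) :
  lam2 (disk t) = ((Num.max t 0)%:E * lam2 (disk 1))%E.
Proof.
have [t0|t0] := leP t 0.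
  (* For [t <= 0] the disk contains at most the origin; otherwise it is scaled to the unit disk. *)
  rewrite mul0e; apply: (@subset_measure0 _ _ _ lam2 _ ([set 0] `*` [set 0])).
  - exact: measurable_disk.
  - exact: measurableX.
  - move=> [x y]; rewrite /disk/= /sqnorm/= => xy.
    have := sqr_ge0 x; have := sqr_ge0 y => y0 x0.
    by split; apply/eqP; rewrite -sqrf_eq0; apply/eqP; lra.
  - transitivity (lam [set 0%R] * lam [set 0%R])%E; first exact: product_measure1E.
    by rewrite lebesgue_measure_set1 mule0.
have st0 : 0 < (Num.sqrt t)^-1 by rewrite invr_gt0 sqrtr_gt0.
rewrite -(lebesgue2_scale st0 (measurable_disk 1)) muleA -EFinM.
rewrite exprVn sqr_sqrtr ?ltW// mulfV ?gt_eqF// mul1e.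
congr lam2; apply/funext => -[x y]; rewrite /disk/= /sqnorm/=.
rewrite !exprMn -mulrDr exprVn sqr_sqrtr ?(ltW t0)// mulrC.
by rewrite ler_pdivrMr// mul1r.
Qed.

(* The pushforward of planar Lebesgue measure by the squared norm is a multiple
   of linear Lebesgue measure: this replaces polar coordinates. *)
Lemma lebesgue2_sqnorm (B : set R) : measurable B -> B `<=` `[0, +oo[ ->
  lam2 (sqnorm @^-1` B) = (lam2 (disk 1) * lam B)%E.
Proof.
move=> mB B0.
have mpos : measurable (`[0, +oo[%classic : set (measurableTypeR R)) by [].
have K0 : 0 <= fine (lam2 (disk 1)) by rewrite fine_ge0// measure_ge0.
have Kfin : lam2 (disk 1) \is a fin_num.
  by rewrite ge0_fin_numE ?measure_ge0// lebesgue2_disk1_lty.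
have mq : measurable_fun [set: measurableTypeR R * measurableTypeR R]
  (sqnorm : _ -> measurableTypeR R) by exact: measurable_sqnorm.
pose m1 := pushforward_measure
  lam2 mq.
(* Restricting to [[0, +oo[] matches the law of [sqnorm], so the two measures can be compared on
   intervals of the whole line. *)
pose m2 : {measure set (measurableTypeR R) -> \bar R} :=
  mscale (NngNum K0) (mrestr lam mpos).
transitivity (m2 B); last first.
  by rewrite /m2/= /mscale/= fineK// /mrestr setIidl.
have m1E (a b : R) : a <= b -> m1 `]a, b]%classic = m2 `]a, b]%classic.
  move=> ab; rewrite /m1 /m2/= /pushforward /mscale/= /mrestr.
  have -> : sqnorm @^-1` `]a, b] = disk b `\` disk a.
    apply/seteqP; split => z; rewrite /disk/= in_itv/=.
      by move=> /andP[az zb]; split => //; apply/negP; rewrite -ltNge.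
    by move=> [zb /negP]; rewrite -ltNge => ->.
  have Dfin : (lam2 (disk b) < +oo)%E by rewrite lebesgue2_disk -(fineK Kfin) -EFinM ltry.
  have : lam2 (disk b `\` disk a) = (lam2 (disk b) - lam2 (disk b `&` disk a))%E.
    by apply: measureD => //; exact: measurable_disk.
  have -> : disk b `&` disk a = disk a.
    by apply/setIidPr => z; rewrite /disk/= => /le_trans; exact.
  move=> DD; transitivity (lam2 (disk b) - lam2 (disk a))%E; first exact: DD.
  transitivity ((fine (lam2 (disk 1)))%:E * (Num.max b 0 - Num.max a 0)%:E)%E.
    rewrite (lebesgue2_disk a) (lebesgue2_disk b) -[in LHS](fineK Kfin).
    by rewrite -!EFinM -EFinB -mulrBl mulrC.
  congr (_ * _)%E.
  (* A negative [a] makes the trace on [[0, +oo[] closed at 0, which does not affect its length; it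
     is empty when [b] is negative too. *)
  have [a0|a0] := ltP a 0.
    have -> : `]a, b] `&` `[0, +oo[ = `[0, b]%classic.
      apply/seteqP; split => x /=; rewrite !in_itv/= andbT.
        by move=> [/andP[_ ->] ->].
      by move=> /andP[x0 ->]; rewrite x0 (lt_le_trans a0).
    by rewrite lebesgue_measure_itv/= lte_fin subr0; case: ltP => _; rewrite -?EFinB ?subr0.
  have -> : `]a, b] `&` `[0, +oo[ = `]a, b]%classic.
    apply/setIidPl => x /=; rewrite !in_itv/= andbT => /andP[ax _].
    by rewrite ltW// (le_lt_trans a0).
  rewrite lebesgue_measure_itv/= lte_fin max_l ?(le_trans a0)//.
  by case: ltgtP ab => // -> _; rewrite subrr.
change (m1 B = m2 B).
apply: (@measure_unique _ R (measurableTypeR R) (@ocitv R)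
  (fun n => `](- n%:R : R), (n%:R : R)]%classic) _ _ _ _ m1 m2) => //.
- exact: ocitvI.
- by move=> n; exists (-n%:R, n%:R).
- rewrite -subTset => /= x _ /=.
  by exists (Num.bound x); rewrite //= in_itv/= ltrNl ltrNbound ltW// ltr_bound.
- move=> _ [[a b] _ <-] /=; have [ab|ba] := leP a b; first exact: m1E.
  by rewrite set_itv_ge ?measure0//= bnd_simp -leNgt ltW.
- move=> n; apply: (@le_lt_trans _ _ (lam2 (disk n%:R))); last first.
    by rewrite lebesgue2_disk -(fineK Kfin) -EFinM ltry.
  have mI : measurable (sqnorm @^-1` `](- n%:R)%R, n%:R%R]).
    by apply: measurable_preimage; [exact: measurable_sqnorm|exact: measurable_itv].
  have IS : sqnorm @^-1` `](- n%:R)%R, n%:R%R] `<=` disk n%:R.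
    by move=> z; rewrite /= in_itv/= => /andP[].
  exact: (le_measure lam2 (mem_set mI) (mem_set (measurable_disk n%:R)) IS).
Qed.

End disk_area.

Section gauss2_disk.
Context {R : realType} (sigma : R).
Hypothesis sigma_gt0 : 0 < sigma.
Local Notation lam := (@lebesgue_measure R).
Local Notation lam2 := (lam \x lam)%E.
Local Notation rate := ((2 * sigma ^+ 2)^-1).

Let rate_gt0 : 0 < rate.
Proof. by rewrite invr_gt0 mulr_gt0 ?exprn_gt0. Qed.

(** The density depends on [z] only through [sqnorm z], and decays exponentially in it. *)
Lemma gauss2_pdf_exponential z : gauss2_pdf sigma z =
  normal_peak sigma ^+ 2 / rate * exponential_pdf rate (sqnorm z).
Proof.
rewrite exponential_pdfE ?sqnorm_ge0// gauss2_pdfE// [RHS]mulrA.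
by rewrite divfK ?gt_eqF// /sqnorm [- _ * _]mulrC mulrN -mulNr.
Qed.

Lemma gauss2_sqnorm (B : set R) : measurable B -> B `<=` `[0, +oo[ ->
  gauss2 sigma (sqnorm @^-1` B) =
  ((normal_peak sigma ^+ 2 / rate)%:E * lam2 (disk 1) * exponential_prob rate B)%E.
Proof.
move=> mB B0; pose f u := ((normal_peak sigma ^+ 2 / rate) * exponential_pdf rate u)%:E.
have c0 : 0 <= normal_peak sigma ^+ 2 / rate.
  by rewrite divr_ge0 ?sqr_ge0// ltW.
have f0 u : (0 <= f u)%E by rewrite lee_fin mulr_ge0// exponential_pdf_ge0// ltW.
have me : measurable_fun setT (exponential_pdf rate).
  exact: measurable_exponential_pdf.
have mf : measurable_fun setT f.
  by apply/measurable_EFinP; apply: measurable_funM.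
have mq : measurable_fun [set: measurableTypeR R * measurableTypeR R]
  (sqnorm : _ -> measurableTypeR R) by exact: measurable_sqnorm.
have K0 : 0 <= fine (lam2 (disk 1)) by rewrite fine_ge0// measure_ge0.
have Kfin : lam2 (disk 1) \is a fin_num.
  by rewrite ge0_fin_numE ?measure_ge0// lebesgue2_disk1_lty.
transitivity (\int[pushforward lam2 (sqnorm : _ -> measurableTypeR R)]_(u in B) f u)%E.
  rewrite ge0_integral_pushforward//; last exact: measurable_funTS.
  by apply: eq_integral => z _; rewrite gauss2_pdf_exponential.
transitivity (\int[mscale (NngNum K0) lam]_(u in B) f u)%E.
  apply: eq_measure_integral => // C mC CB.
  rewrite /= /mscale/= fineK//; apply: lebesgue2_sqnorm => //.
  exact: subset_trans B0.
rewrite ge0_integral_mscale//; last exact: measurable_funTS.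
rewrite /= fineK// (muleC _%:E) -muleA; congr (_ * _)%E.
rewrite /exponential_prob -ge0_integralZl//.
- by apply/measurable_EFinP; exact: measurable_funTS.
- by move=> u _; rewrite lee_fin exponential_pdf_ge0// ltW.
Qed.

Lemma gauss2_disk (t : R) : 0 <= t ->
  gauss2 sigma (disk t) = (1 - expR (- (t / (2 * sigma ^+ 2))))%:E.
Proof.
move=> t0.
(* On [[0, +oo[] both probabilities have total mass 1, which forces the constant to be 1. This
   amounts to the unit disk having area [pi]. *)
have mass : ((normal_peak sigma ^+ 2 / rate)%:E * lam2 (disk 1) = 1)%E.
  have := @gauss2_sqnorm `[0, +oo[%classic.
  have -> : exponential_prob rate `[0, +oo[ = 1%E.
    rewrite -(integral_exponential_pdf rate_gt0) /exponential_prob.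
    rewrite integral_mkcond; apply: eq_integral => u _.
    by rewrite /exponential_pdf/= !patchE; case: (u \in _).
  rewrite mule1 => <-//.
  have -> : sqnorm @^-1` `[0, +oo[ = [set: R] `*` [set: R].
    apply/seteqP; split => // z _; rewrite /= in_itv/= andbT sqnorm_ge0//.
  by rewrite gauss2X// !probability_setT mule1.
have -> : disk t = sqnorm @^-1` `[0, t].
  by apply/seteqP; split => z /=; rewrite in_itv/= sqnorm_ge0.
rewrite gauss2_sqnorm//; last by move=> u /=; rewrite !in_itv/= andbT => /andP[].
rewrite mass mul1e.
have [t_gt0|] := ltP 0 t; last first.
  move=> tle0; have -> : t = 0 by apply/eqP; rewrite eq_le t0 tle0.
  by rewrite set_itv1 /exponential_prob integral_set1 mul0r oppr0 expR0 subrr.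
rewrite exponential_prob_itv0c// -EFinB mulNr.
by rewrite (mulrC _ t).
Qed.

End gauss2_disk.

(** * Centered intervals and erf *)

Section normal_erf.
Context {R : realType} (sigma : R).
Hypothesis sigma_gt0 : 0 < sigma.
Local Notation lam := (@lebesgue_measure R).
Local Notation N := (normal_prob 0 sigma).
Local Notation g := (normal_pdf 0 sigma).

Let measurable_g (D : set R) : measurable_fun D (EFin \o g).
Proof.
by apply/measurable_funTS/measurable_EFinP; exact: measurable_normal_pdf.
Qed.

Let g_ge0 x : (0 <= (EFin \o g) x)%E.
Proof. by rewrite lee_fin normal_pdf_ge0. Qed.

Lemma normal_pdf0N x : g (- x) = g x.
Proof. by rewrite !normal_pdfE ?gt_eqF// /normal_fun !subr0 sqrrN. Qed.

Lemma normal_probN (A : set R) : measurable A -> N (-%R @^-1` A) = N A.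
Proof.
move=> mA; rewrite /normal_prob.
apply: (@ge0_integral_invariant _ (measurableTypeR R) R lam -%R) => //.
- by move=> B mB; exact: lebesgue_measureN.
- exact: measurable_g.
- by move=> z; rewrite normal_pdf0N.
Qed.

Lemma normal_prob_sym_itv (a : R) : 0 <= a ->
  N `[- a, a] = (2%:E * N `[0%R, a])%E.
Proof.
move=> a0.
(* The point 0 is kept in one half only, so that the union is disjoint. *)
have -> : `[- a, a]%classic = (-%R @^-1` `]0%R, a]) `|` `[0%R, a].
  apply/seteqP; split => x /=; rewrite !in_itv/=.
    move=> /andP[h1 h2]; have [x0|x0] := ltP x 0; [left|right] => //.
      by rewrite oppr_gt0 x0 lerNl.
  by case=> /andP[h1 h2]; apply/andP; split; lra.
rewrite measureU//=; last 2 first.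
- by apply: measurable_preimage => //.
- apply/seteqP; split => // x [] /=; rewrite !in_itv/= => /andP[h1 _] /andP[h2 _].
  by exfalso; move: h1; rewrite oppr_gt0 ltNge h2.
rewrite normal_probN// {1}/normal_prob integral_itv_obnd_cbnd//.
by rewrite -[X in (X + _)%E]/(N `[0%R, a]) -mule2n -mule_natl.
Qed.

Lemma ge0_integral_scale (c : R) (f : R -> \bar R) (A : set R) : 0 < c ->
  measurable_fun setT f -> (forall x, 0 <= f x)%E -> measurable A ->
  (c%:E * \int[lam]_(x in (fun x => (c * x)%R) @^-1` A) f (c * x)%R)%E =
  (\int[lam]_(x in A) f x)%E.
Proof.
move=> c0 mf f0 mA; have c0' : 0 <= c by exact: ltW.
have mc : measurable_fun [set: measurableTypeR R]
  (fun x : measurableTypeR R => (c * x : measurableTypeR R)).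
  by apply: measurable_funM.
transitivity (\int[mscale (NngNum c0')
    (pushforward_measure lam mc)]_(x in A) f x)%E.
  rewrite ge0_integral_mscale//=; last exact: measurable_funTS.
  by rewrite ge0_integral_pushforward//; exact: measurable_funTS.
apply: eq_measure_integral => // B mB _.
rewrite /= -[RHS]/(lam B) -(lebesgue_measure_affine 0 c0 mB) /mscale/= /pushforward.
by congr (_ * lam _)%E; apply/seteqP; split => x /=; rewrite addr0.
Qed.

(** The substitution [x = c * u] with [c = sqrt 2 * sigma] turns the normal density into a multiple
    of [gauss_fun]; the bound [b] satisfies [c * b = sqrt t]. *)
Lemma normal_prob_erf (t : R) : 0 <= t ->
  N [set x | x ^+ 2 <= t] = (erf (Num.sqrt (t / (2 * sigma ^+ 2))))%:E.
Proof.
move=> t0; set b := Num.sqrt (t / _); pose c := Num.sqrt 2 * sigma.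
have b0 : 0 <= b by exact: sqrtr_ge0.
have c0 : 0 < c by rewrite mulr_gt0// sqrtr_gt0.
have c2 : c ^+ 2 = 2 * sigma ^+ 2 by rewrite exprMn sqr_sqrtr.
have t2 : (c * b) ^+ 2 = t.
  rewrite exprMn sqr_sqrtr ?divr_ge0 ?mulr_ge0 ?sqr_ge0 ?(ltW sigma_gt0)// c2.
  by rewrite mulrC divfK// -c2 expf_neq0 ?gt_eqF.
transitivity (N `[- (c * b), c * b]%classic).
  congr (N _); apply/seteqP; split => x /=; rewrite in_itv/= -ler_norml -t2.
    by rewrite -real_normK ?num_real// ler_pXn2r// nnegrE ?mulr_ge0// ltW.
  by move=> ?; rewrite -real_normK ?num_real// ler_pXn2r// nnegrE ?mulr_ge0// ltW.
rewrite normal_prob_sym_itv; last by rewrite mulr_ge0// ltW.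
(* Selects the branch of [erf] for nonnegative arguments. *)
rewrite /erf b0.
rewrite /normal_prob -(@ge0_integral_scale c (EFin \o g) _ c0 (@measurable_g setT) g_ge0) /=; last first.
  exact: measurable_itv.
have -> : ( *%R c) @^-1` `[0%R, c * b] = `[0%R, b]%classic.
  apply/seteqP; split => x /=; rewrite !in_itv/=.
    by rewrite pmulr_rge0// ler_pM2l.
  by rewrite pmulr_rge0// ler_pM2l.
have gE x : g (c * x) = (c * Num.sqrt pi)^-1 * gauss_fun x.
  rewrite normal_pdfE ?gt_eqF// /normal_fun subr0 exprMn c2; congr (_ * expR _).
    rewrite /normal_peak; congr (_^-1).
    rewrite -mulrnAr sqrtrM ?sqr_ge0// sqrtr_sqr gtr0_norm//.
    by rewrite -mulr_natl sqrtrM// mulrA (mulrC sigma).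
  by field; rewrite gt_eqF.
have spi : 0 < Num.sqrt (pi : R) by rewrite sqrtr_gt0 pi_gt0.
have ig : lam.-integrable `[0, b] (EFin \o gauss_fun).
  exact: (integrableS _ _ _ integrableT_gauss).
under eq_integral do rewrite gE EFinM.
rewrite ge0_integralZl//; last 3 first.
- by case/integrableP : ig.
- by move=> x _; rewrite lee_fin gauss_fun_ge0.
- by rewrite lee_fin invr_ge0 mulr_ge0// ltW.
rewrite [RHS]EFinM /Rintegral fineK; last exact: integrable_fin_num.
rewrite !muleA -!EFinM; congr (_%:E * _)%E.
by field; rewrite !gt_eqF.
Qed.

End normal_erf.

(** * Laws of squared linear forms in i.i.d. Gaussian variables *)

Section iid_normal_forms.
Context {d : measure_display} {T : measurableType d} {R : realType}.
Variables (P : probability T R) (I : finType) (sigma : R) (X : I -> T -> R).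
Hypotheses (sigma_gt0 : 0 < sigma) (iidX : iid_normal P sigma X).

(** A first reduction aligns [u] with the basis vector [i]; orthogonality then cancels coordinate
    [i] of the image of [v]. A second reduction, confined to the complement of [i], aligns that
    image with [j] without disturbing [Y i]. *)
Lemma iid_normal_reduce2 (u v : I -> R) : (1 < #|I|)%N ->
  \sum_i u i ^+ 2 != 0 -> \sum_i u i * v i = 0 ->
  exists (Y : I -> T -> R) i j r q, [/\ iid_normal P sigma Y, i != j,
    r ^+ 2 = \sum_i u i ^+ 2, q ^+ 2 = \sum_i v i ^+ 2 &
    forall w, \sum_i u i * X i w = r * Y i w /\ \sum_i v i * X i w = q * Y j w].
Proof.
move=> /card_gt1P[i [j [_ _ ij]]] u0 uv.
have [||Y [r [iidY _ r2 uY vY]]] :=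
    @iid_normal_reduce _ _ _ P I sigma sigma_gt0 [set: I]%SET i u X _ _ iidX.
- by rewrite finset.in_setT.
- by move=> k; rewrite finset.in_setT.
have [v' [v'Y v'2 uv']] := vY v.
have v'i : v' i = 0.
  move/eqP: uv'; rewrite uv eq_sym mulf_eq0 => /orP[/eqP r0|/eqP//].
  by move: u0; rewrite -r2 r0 expr0n eqxx.
have [||Z [q [iidZ ZY q2 vZ _]]] :=
    @iid_normal_reduce _ _ _ P I sigma sigma_gt0 (~: [set i])%SET j v' Y _ _ iidY.
- by rewrite !finset.inE eq_sym.
- by move=> k; rewrite !finset.inE negbK => /eqP ->.
exists Z, i, j, r, q; split => //; first by rewrite q2 v'2.
by move=> w; rewrite uY v'Y vZ ZY// !finset.inE negbK.
Qed.

Lemma iid_normal_linear_sq (u : I -> R) (t : R) : 0 <= t ->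
  0 < \sum_i u i ^+ 2 ->
  P [set w | (\sum_i u i * X i w) ^+ 2 <= (\sum_i u i ^+ 2) * t] =
  (erf (Num.sqrt (t / (2 * sigma ^+ 2))))%:E.
Proof.
move=> t0 u0.
(* A positive sum has at least one index. *)
have [i _ _] : exists2 i : I, true & true.
  case: (pickP I) => [i _|I0]; first by exists i.
  by move: u0; rewrite big_pred0 ?ltxx.
have [||Y [r [iidY _ r2 uY _]]] :=
    @iid_normal_reduce _ _ _ P I sigma sigma_gt0 [set: I]%SET i u X _ _ iidX.
- by rewrite finset.in_setT.
- by move=> k; rewrite finset.in_setT.
pose A : set R := [set x | x ^+ 2 <= t].
have mA : measurable A.
  have -> : A = (fun x => x ^+ 2) @^-1` `]-oo, t].
    by apply/seteqP; split => x /=; rewrite in_itv.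
  by apply: measurable_preimage; [exact: measurable_funX|exact: measurable_itv].
rewrite -normal_prob_erf// -(iid_normal1 i iidY mA); congr (P _).
by apply/funext => w; rewrite /A/= uY exprMn r2 ler_pM2l.
Qed.

(** Because both forms have the same squared norm [c], the event is that a standard pair
    [(Y i, Y j)] falls in a disk rather than in an ellipse. *)
Lemma iid_normal_linear2_sq (u v : I -> R) (c t : R) : (1 < #|I|)%N -> 0 <= t ->
  0 < c -> \sum_i u i ^+ 2 = c -> \sum_i v i ^+ 2 = c ->
  \sum_i u i * v i = 0 ->
  P [set w | (\sum_i u i * X i w) ^+ 2 + (\sum_i v i * X i w) ^+ 2 <= c * t] =
  (1 - expR (- (t / (2 * sigma ^+ 2))))%:E.
Proof.
move=> I1 t0 c0 u2 v2 uv.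
have [|Y [i [j [r [q [iidY ij r2 q2 uvY]]]]]] := @iid_normal_reduce2 u v I1 _ uv.
  by rewrite u2 gt_eqF.
rewrite -gauss2_disk// -(iid_normal_pairT iidY ij (measurable_disk t)).
congr (P _); apply/funext => w /=; have [-> ->] := uvY w.
by rewrite /disk/= /sqnorm/= !exprMn r2 q2 u2 v2 -mulrDr ler_pM2l.
Qed.

End iid_normal_forms.

Lemma independent_iid_normal (d : measure_display) (T : measurableType d)
    (R : realType) (P : probability T R) (I : finType) (X : I -> {RV P >-> R})
    (sigma : R) :
  mutually_independent X -> (forall i, has_normal_law (X i) 0 sigma) ->
  iid_normal P sigma (fun i w => X i w).
Proof.
move=> indX lawX; split=> [i|B mB]; first exact: measurable_funP.
have := indX [set: I]%SET B mB.
under eq_bigl do rewrite finset.in_setT.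
have -> : (\prod_i P (X i @^-1` B i) = \prod_i normal_prob 0 sigma (B i))%E.
  by apply: eq_bigr => i _; exact: lawX.
move=> <-; congr (P _); apply/seteqP; split => w /= h i; first by move=> _; exact: h.
by apply: h; rewrite /= finset.in_setT.
Qed.


(** * Trigonometric sums and the DFT *)

Section trig_sums.
Context {R : realType}.

Lemma cos_natpi2 (m : nat) : cos (m%:R * (2 * pi)) = 1 :> R.
Proof.
have := periodicn (@cosD2pi R) m 0; rewrite add0r cos0 => c1.
by rewrite -[RHS]c1 -(mulr_natl (pi *+ 2) m) -(mulr_natl pi 2).
Qed.

Lemma sin_natpi2 (m : nat) : sin (m%:R * (2 * pi)) = 0 :> R.
Proof.
have := periodicn (@sinD2pi R) m 0; rewrite add0r sin0 => s0.
by rewrite -[RHS]s0 -(mulr_natl (pi *+ 2) m) -(mulr_natl pi 2).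
Qed.

Lemma sin_natpi (m : nat) : sin (m%:R * pi) = 0 :> R.
Proof.
elim: m => [|m IH]; first by rewrite mul0r sin0.
by rewrite -natr1 mulrDl mul1r sinDpi IH oppr0.
Qed.

(* Rotating by [x] permutes the terms cyclically, so it fixes the sum. *)
Lemma sum_cos_sin_eq0 (n : nat) (x : R) :
  cos (n%:R * x) = 1 -> sin (n%:R * x) = 0 -> cos x != 1 ->
  (\sum_(i < n) cos (i%:R * x) = 0) * (\sum_(i < n) sin (i%:R * x) = 0).
Proof.
move=> cn sn cx; set C := \sum_(i < n) _; set S := \sum_(i < n) _.
have eC : \sum_(i < n) cos (i.+1%:R * x) = C.
  apply: (addIr (cos (0%:R * x))); rewrite addrC -(big_ord_recl n (fun i => cos (i%:R * x))).
  by rewrite big_ord_recr/= cn mul0r cos0.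
have eS : \sum_(i < n) sin (i.+1%:R * x) = S.
  apply: (addIr (sin (0%:R * x))); rewrite addrC -(big_ord_recl n (fun i => sin (i%:R * x))).
  by rewrite big_ord_recr/= sn mul0r sin0.
have dC : C = C * cos x - S * sin x.
  rewrite -{1}eC !mulr_suml -sumrB; apply: eq_bigr => i _.
  by rewrite -natr1 mulrDl mul1r cosD.
have dS : S = S * cos x + C * sin x.
  rewrite -{1}eS !mulr_suml -big_split; apply: eq_bigr => i _.
  by rewrite -natr1 mulrDl mul1r sinD.
(* Determinant of the linear system [e1], [e2] in the unknowns [C] and [S]. *)
have nz : (1 - cos x) ^+ 2 + sin x ^+ 2 != 0.
  by rewrite gt_eqF// ltr_pwDl ?sqr_ge0// lt_def sqr_ge0 sqrf_eq0 subr_eq0 eq_sym cx.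
have e1 : C * (1 - cos x) + S * sin x = 0 by rewrite mulrBr mulr1 {1}dC; ring.
have e2 : S * (1 - cos x) - C * sin x = 0 by rewrite mulrBr mulr1 {1}dS; ring.
split; apply: (mulIf nz); rewrite mul0r.
  transitivity ((1 - cos x) * (C * (1 - cos x) + S * sin x) -
    sin x * (S * (1 - cos x) - C * sin x)); first ring.
  by rewrite e1 e2 !mulr0 subrr.
transitivity ((1 - cos x) * (S * (1 - cos x) - C * sin x) +
  sin x * (C * (1 - cos x) + S * sin x)); first ring.
by rewrite e1 e2 !mulr0 addr0.
Qed.

End trig_sums.

(** * The replica power as a sum of two squared real linear forms *)

Section skew_power.
Local Open Scope complex_scope.
Context {R : realType}.

Lemma sum_complex (I : finType) (a b : I -> R) :
  \sum_i (a i +i* b i) = (\sum_i a i) +i* (\sum_i b i).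
Proof. by elim/big_rec3: _ => // i x y z _ ->. Qed.

Definition dft_angle (N k : nat) : R := - (2 * pi * k%:R / N%:R).

Lemma dftE (N : nat) (s : 'I_N -> R) (k : nat) :
  dft s k = (N%:R^-1 * \sum_(n < N) cos (n%:R * dft_angle N k) * s n) +i*
            (N%:R^-1 * \sum_(n < N) sin (n%:R * dft_angle N k) * s n).
Proof.
have E (n : 'I_N) : cexp ((- (2 * pi * k%:R * n%:R / N%:R)) *i) * (s n)%:C =
    (cos (n%:R * dft_angle N k) * s n) +i* (sin (n%:R * dft_angle N k) * s n).
  have -> : n%:R * dft_angle N k = - (2 * pi * k%:R * n%:R / N%:R) by
    rewrite /dft_angle; ring.
  rewrite /cexp/= expR0 !mul1r; apply/eqP; rewrite eq_complex/=.
  by rewrite !mulr0 subr0 add0r !eqxx.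
rewrite /dft; under eq_bigr do rewrite E.
rewrite sum_complex -(rmorph_nat (real_complex R)) -fmorphV.
by apply/eqP; rewrite eq_complex/= !mul0r subr0 addr0 !eqxx.
Qed.

Lemma skew_powerE (N : nat) (fsig : R) (s : 'I_N -> R) (k : nat) :
  skew_power fsig s k = (2 * pi * fsig / N%:R) ^+ 2 *
    ((\sum_(n < N) cos (n%:R * dft_angle N k) * s n) ^+ 2 +
     (\sum_(n < N) sin (n%:R * dft_angle N k) * s n) ^+ 2).
Proof.
rewrite /skew_power dftE /= sqr_sqrtr ?addr_ge0 ?sqr_ge0//.
by rewrite !exprMn -mulrDr mulrA.
Qed.

Lemma skew_power_le (N : nat) (fsig : R) (s : 'I_N -> R) (k : nat) (p : R) :
  (0 < N)%N -> 0 < fsig ->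
  (skew_power fsig s k <= p) =
  ((\sum_(n < N) cos (n%:R * dft_angle N k) * s n) ^+ 2 +
     (\sum_(n < N) sin (n%:R * dft_angle N k) * s n) ^+ 2 <=
   p / (2 * pi * fsig / N%:R) ^+ 2).
Proof.
move=> N0 f0; rewrite skew_powerE mulrC -ler_pdivlMr// exprn_gt0// divr_gt0 ?ltr0n//.
by rewrite !mulr_gt0// pi_gt0.
Qed.

End skew_power.

(** * Norms and orthogonality of the cosine and sine vectors of a bin *)

Section dft_sums.
Context {R : realType} (N k : nat).
Hypotheses (k0 : (0 < k)%N) (kN : (2 * k < N)%N).
Local Notation x := (@dft_angle R N k).

Let N0 : N%:R != 0 :> R.
Proof. by rewrite pnatr_eq0; case: N kN. Qed.

(** The power-reduction formulas express the squares and the product of cosine and sine through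
    these doubled-angle sums, taken over full periods. *)
Lemma dft_sums2 : (\sum_(n < N) cos (n%:R * (2 * x)) = 0) *
  (\sum_(n < N) sin (n%:R * (2 * x)) = 0).
Proof.
have Nx : N%:R * (2 * x) = - ((2 * k)%:R * (2 * pi)).
  by rewrite /dft_angle natrM; field.
apply: sum_cos_sin_eq0.
- by rewrite Nx cosN cos_natpi2.
- by rewrite Nx sinN sin_natpi2 oppr0.
(* Since [cos (2 * x) - 1] equals [- 2 * sin x ^+ 2], it suffices that [sin x] is nonzero:
   [0 < 2 * k < N] puts [- x] strictly between 0 and [pi]. *)
have -> : 2 * x = x *+ 2 by rewrite mulr_natl.
rewrite cos_mulr2n -subr_eq0.
have -> : cos x ^+ 2 *+ 2 - 1 - 1 = - (sin x ^+ 2 *+ 2).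
  by rewrite sin2cos2 mulrnBl; ring.
rewrite oppr_eq0 mulrn_eq0/= sqrf_eq0 /dft_angle sinN oppr_eq0 gt_eqF//.
apply: sin_gt0_pi.
have k0' : 0 < k%:R :> R by rewrite ltr0n.
have N0' : 0 < N%:R :> R by rewrite lt_def N0 ler0n.
have kN' : 2 * k%:R < N%:R :> R by rewrite -natrM ltr_nat.
rewrite divr_gt0 ?mulr_gt0 ?pi_gt0//= ltr_pdivrMr// mulrAC mulrC.
by rewrite ltr_pM2l ?pi_gt0.
Qed.

Lemma sum_dft_cos2 : \sum_(n < N) cos (n%:R * x) ^+ 2 = N%:R / 2.
Proof.
have [c0 _] := dft_sums2.
have -> : \sum_(n < N) cos (n%:R * x) ^+ 2 =
    \sum_(n < N) (1 / 2 + cos (n%:R * (2 * x)) / 2).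
  apply: eq_bigr => n _.
  have -> : n%:R * (2 * x) = (n%:R * x) *+ 2 by rewrite -[RHS]mulr_natl mulrCA.
  rewrite cos_mulr2n.
  by rewrite -[_ *+ 2]mulr_natl; field.
rewrite big_split/= -[X in _ + X]mulr_suml c0 mul0r addr0 sumr_const card_ord.
by rewrite mul1r -[LHS]mulr_natl.
Qed.

Lemma sum_dft_sin2 : \sum_(n < N) sin (n%:R * x) ^+ 2 = N%:R / 2.
Proof.
under eq_bigr do rewrite sin2cos2.
rewrite sumrB sum_dft_cos2 sumr_const card_ord; by field.
Qed.

Lemma sum_dft_cos_sin : \sum_(n < N) cos (n%:R * x) * sin (n%:R * x) = 0.
Proof.
have [_ s0] := dft_sums2.
have -> : \sum_(n < N) cos (n%:R * x) * sin (n%:R * x) =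
    \sum_(n < N) sin (n%:R * (2 * x)) / 2.
  apply: eq_bigr => n _.
  have -> : n%:R * (2 * x) = (n%:R * x) *+ 2 by rewrite -[RHS]mulr_natl mulrCA.
  rewrite sin_mulr2n.
  by rewrite -[_ *+ 2]mulr_natl; field.
by rewrite -mulr_suml s0 mul0r.
Qed.

End dft_sums.

Unset Implicit Arguments.

Theorem mainTheorem7 (R : realType) (d : measure_display) (T : measurableType d)
    (P : probability T R) (N : nat) (fsig sigma : R)
    (s : 'I_N -> {RV P >-> R})
    (hN : (2 <= N)%N) (hf : 0 < fsig) (hsigma : 0 < sigma)
    (hindep : mutually_independent s)
    (hlaw : forall n : 'I_N, has_normal_law (s n) 0 sigma) :
  forall p : R, 0 <= p ->
    (~~ odd N ->
      P [set w | skew_power fsig (fun n => s n w) N./2 <= p] =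
      (erf (Num.sqrt (N%:R * p / (8 * pi ^+ 2 * fsig ^+ 2 * sigma ^+ 2))))%:E) /\
    (forall k : nat, (0 < k)%N -> (2 * k < N)%N ->
      P [set w | skew_power fsig (fun n => s n w) k <= p] =
      (1 - expR (- (N%:R * p / (4 * pi ^+ 2 * fsig ^+ 2 * sigma ^+ 2))))%:E).
Proof.
move=> p p0; have iid := independent_iid_normal hindep hlaw.
have N0 : (0 < N)%N by exact: ltnW.
have N0' : 0 < N%:R :> R by rewrite ltr0n.
have [nzN nzpi nzf nzs] : [/\ N%:R != 0 :> R, pi != 0 :> R, fsig != 0 & sigma != 0].
  by rewrite !gt_eqF ?pi_gt0.
(* The identities are proved for a variable [q], since field unfolds [pi]. *)
have e1 q : q != 0 ->
    p / (2 * q * fsig / N%:R) ^+ 2 = N%:R * (N%:R * p / (2 * q * fsig) ^+ 2).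
  by move=> q0; field; rewrite nzf q0 nzN.
have e2 q : q != 0 -> N%:R * p / (2 * q * fsig) ^+ 2 / (2 * sigma ^+ 2) =
    N%:R * p / (8 * q ^+ 2 * fsig ^+ 2 * sigma ^+ 2).
  by move=> q0; field; rewrite nzf q0 nzs.
have e3 q : q != 0 -> p / (2 * q * fsig / N%:R) ^+ 2 =
    N%:R / 2 * (2 * N%:R * p / (2 * q * fsig) ^+ 2).
  by move=> q0; field; rewrite nzf q0 nzN.
have e4 q : q != 0 -> 2 * N%:R * p / (2 * q * fsig) ^+ 2 / (2 * sigma ^+ 2) =
    N%:R * p / (4 * q ^+ 2 * fsig ^+ 2 * sigma ^+ 2).
  by move=> q0; field; rewrite nzf q0 nzs.
split=> [evenN|k k0 kN].
(* The cosine vector has squared norm [N] here, so the threshold is written as [N * t]. *)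
- pose t := N%:R * p / (2 * pi * fsig) ^+ 2.
  have t0 : 0 <= t by rewrite divr_ge0 ?sqr_ge0// mulr_ge0// ltW.
  have half : (N./2)%:R = N%:R / 2 :> R.
    rewrite -[in RHS](odd_double_half N) (negbTE evenN) -mul2n natrM.
    by rewrite mulrAC mulfV ?mul1r// pnatr_eq0.
  (* The angle of bin [N / 2] is [- pi], which makes the imaginary part vanish and every squared
     cosine equal to 1. *)
  have sin0 n : sin (n%:R * @dft_angle R N N./2) = 0 :> R.
    have -> : n%:R * @dft_angle R N N./2 = - (n%:R * pi).
      by rewrite /dft_angle half; field.
    by rewrite sinN sin_natpi oppr0.
  have cos2 : \sum_(n < N) cos (n%:R * @dft_angle R N N./2) ^+ 2 = N%:R.
    under eq_bigr do rewrite cos2sin2 sin0 expr0n subr0.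
    by rewrite sumr_const card_ord.
  have := @iid_normal_linear_sq _ _ _ P _ sigma _ hsigma iid
    (fun n => cos (n%:R * @dft_angle R N N./2)) t t0.
  rewrite cos2 => /(_ N0') E.
  transitivity (erf (Num.sqrt (t / (2 * sigma ^+ 2))))%:E.
    rewrite -E; congr (P _); apply/funext => w /=; rewrite skew_power_le//.
    under [X in _ + X ^+ 2]eq_bigr do rewrite sin0 mul0r.
    rewrite sumr_const mul0rn expr0n addr0; congr (is_true (_ <= _)).
    by rewrite /t (e1 _ nzpi).
  by rewrite /t (e2 _ nzpi).
(* The factor 2 compensates for the squared norm [N / 2] shared by the cosine and sine vectors. *)
- pose t := 2 * N%:R * p / (2 * pi * fsig) ^+ 2.
  have t0 : 0 <= t by rewrite divr_ge0 ?sqr_ge0// !mulr_ge0// ltW.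
  have := @iid_normal_linear2_sq _ _ _ P _ sigma _ hsigma iid
    (fun n => cos (n%:R * @dft_angle R N k))
    (fun n => sin (n%:R * @dft_angle R N k)) (N%:R / 2) t.
  rewrite card_ord => /(_ hN t0 _ (sum_dft_cos2 k0 kN) (sum_dft_sin2 k0 kN)
    (sum_dft_cos_sin k0 kN)) E.
  transitivity (1 - expR (- (t / (2 * sigma ^+ 2))))%:E.
    rewrite -E ?divr_gt0//; congr (P _); apply/funext => w /=.
    rewrite skew_power_le//; congr (is_true (_ <= _)).
    by rewrite /t (e3 _ nzpi).
  by rewrite /t (e4 _ nzpi).
Qed.
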